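(* Let $B$ be a bialgebra over a field $\Bbbk$ such that $\mathrm{Id}$ is algebraic over $\Bbbk$ in the convolution algebra $\mathrm{End}_\Bbbk(B)$ (this is true, for instance, for any finite-dimensional bialgebra). Then $B$ has a left $n$-antipode $S$ for some $n\in\mathbb{N}$, which additionally satisfies $S*\mathrm{Id}=\mathrm{Id}*S$. In particular, $S$ is a two-sided $n$-antipode.
   Context: $*$ denotes the convolution product on $\mathrm{End}_\Bbbk(B)$ and $f^{*k}$ the $k$-th convolution power (with $f^{*0}=u\circ\varepsilon$, $u$ the unit and $\varepsilon$ the counit of $B$). A left $n$-Hopf algebra is a bialgebra $B$ such that $n\in\mathbb{N}$ is minimal with the property that there is $S\in\mathrm{End}_\Bbbk(B)$ with $S*\mathrm{Id}^{*(n+1)}=\mathrm{Id}^{*n}$; such an $S$, for this minimal $n$, is called a left $n$-antipode. Similarly, a right $n$-antipode is an $S$ with $\mathrm{Id}^{*(n+1)}*S=\mathrm{Id}^{*n}$, with $n$ minimal for which such an $S$ exists. A two-sided $n$-antipode is an $S$ which is both a left and a right $n$-antipode. *)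

(* Defs.v *)
From HB Require Import structures.
From mathcomp Require Import all_boot all_order all_algebra.
From mathcomp Require Import boolp.
Set Implicit Arguments.
Unset Strict Implicit.
Unset Printing Implicit Defensive.
Import GRing.Theory.
Local Open Scope ring_scope.
Local Open Scope quotient_scope.

Reserved Notation "u \ox v" (at level 40, left associativity).

Lemma bilinearDZ (k : fieldType) (U V W : lmodType k) (f : U -> V -> W) :
  (forall v, {morph f^~ v : u u' / u + u'}) ->
  (forall u, {morph f u : v v' / v + v'}) ->
  (forall a u v, f (a *: u) v = a *: f u v) ->
  (forall a u v, f u (a *: v) = a *: f u v) ->
  bilinear_for *:%R *:%R f.
Proof.
by move=> fDl fDr fZl fZr; split=> [v a u u'|u a v v'];
  rewrite ?fDl ?fDr ?fZl ?fZr.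
Qed.

Section TensorType.
Variables (k : fieldType) (U V : lmodType k).

(* The formal sum u_1 (x) v_1 + ... + u_n (x) v_n is the sequence of the      *)
(* pairs (u_i, v_i), and tens_rel is the congruence of the monoid of formal   *)
(* sums that makes (x) bilinear.  Scalars need no separate symbol, since      *)
(* a (u (x) v) = (a u) (x) v.                                                 *)
Inductive tens_rel : seq (U * V) -> seq (U * V) -> Prop :=
| TensRefl s : tens_rel s s
| TensSym s t : tens_rel s t -> tens_rel t s
| TensTrans t s r : tens_rel s t -> tens_rel t r -> tens_rel s r
| TensCat s s' t t' :
    tens_rel s s' -> tens_rel t t' -> tens_rel (s ++ t) (s' ++ t')
| TensComm s t : tens_rel (s ++ t) (t ++ s)
| Tens0 v : tens_rel [:: (0, v)] [::]
| TensDl u u' v : tens_rel [:: (u + u', v)] [:: (u, v); (u', v)]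
| TensDr u v v' : tens_rel [:: (u, v + v')] [:: (u, v); (u, v')]
| TensZ a u v : tens_rel [:: (a *: u, v)] [:: (u, a *: v)].

Definition tens_relb (s t : seq (U * V)) : bool := `[< tens_rel s t >].

Lemma tens_relb_refl : reflexive tens_relb.
Proof. by move=> s; apply/asboolP/TensRefl. Qed.

Lemma tens_relb_sym : symmetric tens_relb.
Proof. by move=> s t; apply/idP/idP=> /asboolP/TensSym/asboolP. Qed.

Lemma tens_relb_trans : transitive tens_relb.
Proof.
by move=> t s r /asboolP st /asboolP tr; apply/asboolP/(TensTrans st tr).
Qed.

Canonical tens_equiv :=
  EquivRel tens_relb tens_relb_refl tens_relb_sym tens_relb_trans.

Definition tensor := {eq_quot tens_equiv}.

HB.instance Definition _ := Choice.on tensor.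

Definition tens_class (s : seq (U * V)) : tensor := \pi_{eq_quot tens_equiv} s.
Definition tens_repr (x : tensor) : seq (U * V) := repr x.

Lemma tens_reprK : cancel tens_repr tens_class.
Proof. by move=> x; rewrite /tens_class /tens_repr reprK. Qed.

Lemma tens_classP s t : tens_class s = tens_class t <-> tens_rel s t.
Proof.
split=> [/eqquotP/asboolP //|st].
by apply/eqquotP; apply/asboolP.
Qed.

Lemma tens_repr_class s : tens_rel (tens_repr (tens_class s)) s.
Proof. by apply/tens_classP; rewrite tens_reprK. Qed.

Definition tens_zero : tensor := tens_class [::].
Definition tens_add (x y : tensor) : tensor :=
  tens_class (tens_repr x ++ tens_repr y).
Definition tens_scale (a : k) (x : tensor) : tensor :=
  tens_class [seq (a *: p.1, p.2) | p <- tens_repr x].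

Lemma tens_class_cat s t :
  tens_class (s ++ t) = tens_add (tens_class s) (tens_class t).
Proof.
by apply/tens_classP/TensSym/TensCat; apply: tens_repr_class.
Qed.

Lemma tens_rel_scale a s t : tens_rel s t ->
  tens_rel [seq (a *: p.1, p.2) | p <- s] [seq (a *: p.1, p.2) | p <- t].
Proof.
elim=> {s t} /=.
- by move=> s; apply: TensRefl.
- by move=> s t _; apply: TensSym.
- by move=> t s r _ st _; apply: TensTrans.
- by move=> s1 s2 t1 t2 _ h1 _ h2; rewrite !map_cat; apply: TensCat.
- by move=> s1 s2; rewrite !map_cat; apply: TensComm.
- by move=> v; rewrite scaler0; apply: Tens0.
- by move=> u u' v; rewrite scalerDr; apply: TensDl.
- by move=> u v v'; apply: TensDr.
- by move=> b u v; rewrite scalerA mulrC -scalerA; apply: TensZ.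
Qed.

Lemma tens_class_scale a s :
  tens_scale a (tens_class s) = tens_class [seq (a *: p.1, p.2) | p <- s].
Proof. by apply/tens_classP/tens_rel_scale/tens_repr_class. Qed.

Lemma tens_addA : associative tens_add.
Proof.
move=> x y z; rewrite -(tens_reprK x) -(tens_reprK y) -(tens_reprK z).
by rewrite -!tens_class_cat catA.
Qed.

Lemma tens_addC : commutative tens_add.
Proof. by move=> x y; apply/tens_classP/TensComm. Qed.

Lemma tens_add0 : left_id tens_zero tens_add.
Proof. by move=> x; rewrite -[x]tens_reprK -tens_class_cat. Qed.

HB.instance Definition _ := GRing.isNmodule.Build tensor
  tens_addA tens_addC tens_add0.

Lemma tens_class_cons p s :
  tens_class (p :: s) = tens_class [:: p] + tens_class s.
Proof. by rewrite -cat1s tens_class_cat. Qed.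

Lemma tens_addN : left_inverse 0 (tens_scale (-1)) +%R.
Proof.
move=> x; rewrite -[x]tens_reprK tens_class_scale.
elim: (tens_repr x) => [|[u v] s IHs] /=; first exact: addr0.
rewrite tens_class_cons (tens_class_cons (u, v)) addrACA IHs addr0.
rewrite -[LHS]tens_class_cat; apply/tens_classP.
apply: (TensTrans (TensSym (TensDl _ _ _))).
by rewrite scaleN1r addNr; apply: Tens0.
Qed.

HB.instance Definition _ := GRing.Nmodule_isZmodule.Build tensor tens_addN.

Lemma tens_scaleA a b x : tens_scale a (tens_scale b x) = tens_scale (a * b) x.
Proof.
rewrite -[x]tens_reprK !tens_class_scale -map_comp; congr tens_class.
by apply: eq_map => p /=; rewrite scalerA.
Qed.

Lemma tens_scale1 : left_id 1 tens_scale.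
Proof.
move=> x; rewrite -[x]tens_reprK tens_class_scale; congr tens_class.
by rewrite -[RHS]map_id; apply: eq_map => -[u v] /=; rewrite scale1r.
Qed.

Lemma tens_scaleDr : right_distributive tens_scale +%R.
Proof.
move=> a x y; rewrite -(tens_reprK x) -(tens_reprK y).
by rewrite -[_ + _]tens_class_cat !tens_class_scale map_cat tens_class_cat.
Qed.

Lemma tens_scaleDl x : {morph tens_scale^~ x : a b / a + b}.
Proof.
move=> a b; rewrite -[x]tens_reprK !tens_class_scale.
elim: (tens_repr x) => [|[u v] s IHs] /=; first by rewrite addr0.
rewrite tens_class_cons (tens_class_cons (a *: u, v)).
rewrite (tens_class_cons (b *: u, v)) addrACA -IHs; congr (_ + _).
rewrite -[RHS]tens_class_cat; apply/tens_classP.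
by rewrite scalerDl; apply: TensDl.
Qed.

HB.instance Definition _ := GRing.Zmodule_isLmodule.Build k tensor
  tens_scaleA tens_scale1 tens_scaleDr tens_scaleDl.

Definition tens (u : U) (v : V) : tensor := tens_class [:: (u, v)].

Lemma tens_scalel a u v : tens (a *: u) v = a *: tens u v.
Proof. by rewrite -[RHS]/(tens_scale a _) tens_class_scale. Qed.

Lemma tens_is_bilinear : bilinear_for *:%R *:%R tens.
Proof.
apply: bilinearDZ => [v u u'|u v v'|a u v|a u v].
- by rewrite -[RHS]tens_class_cat; apply/tens_classP/TensDl.
- by rewrite -[RHS]tens_class_cat; apply/tens_classP/TensDr.
- exact: tens_scalel.
- by rewrite -tens_scalel; apply/tens_classP/TensSym/TensZ.
Qed.

HB.instance Definition _ :=
  bilinear_isBilinear.Build k U V tensor *:%R *:%R tens tens_is_bilinear.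

Lemma tens_ind (P : tensor -> Prop) :
    (forall u v, P (tens u v)) -> (forall x y, P x -> P y -> P (x + y)) ->
  forall x, P x.
Proof.
move=> Ptens PD x; rewrite -[x]tens_reprK.
elim: (tens_repr x) => [|[u v] s IHs].
  by have := Ptens 0 0; rewrite linear0l.
by rewrite tens_class_cons; apply: PD (IHs); apply: Ptens.
Qed.

Section Lift.
Variables (W : lmodType k) (f : {bilinear U -> V -> W}).

Definition tens_lift (x : tensor) : W := \sum_(p <- tens_repr x) f p.1 p.2.

Lemma tens_rel_sum s t : tens_rel s t ->
  \sum_(p <- s) f p.1 p.2 = \sum_(p <- t) f p.1 p.2.
Proof.
elim=> {s t} //=.
- by move=> t s r _ -> _ ->.
- by move=> s1 s2 t1 t2 _ h1 _ h2; rewrite !big_cat /= h1 h2.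
- by move=> s t; rewrite !big_cat /= addrC.
- by move=> v; rewrite big_seq1 big_nil linear0l.
- by move=> u u' v; rewrite !big_cons !big_nil !addr0 linearDl.
- by move=> u v v'; rewrite !big_cons !big_nil !addr0 linearDr.
- by move=> a u v; rewrite !big_seq1 linearZl_LR linearZr_LR.
Qed.

Lemma tens_lift_class s : tens_lift (tens_class s) = \sum_(p <- s) f p.1 p.2.
Proof. exact/tens_rel_sum/tens_repr_class. Qed.

Lemma tens_liftE u v : tens_lift (tens u v) = f u v.
Proof. by rewrite tens_lift_class big_seq1. Qed.

Lemma tens_lift_is_linear : linear tens_lift.
Proof.
move=> a x y; rewrite -(tens_reprK x) -(tens_reprK y).
rewrite -[a *: _]/(tens_scale _ _) tens_class_scale -[_ + _]tens_class_cat.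
rewrite !tens_lift_class big_cat big_map scaler_sumr; congr (_ + _).
by apply: eq_bigr => p _; rewrite linearZl_LR.
Qed.

HB.instance Definition _ := GRing.isLinear.Build k tensor W *:%R tens_lift
  tens_lift_is_linear.

Lemma tens_lift_uniq (g : {linear tensor -> W}) :
  (forall u v, g (tens u v) = f u v) -> g =1 tens_lift.
Proof.
move=> gE x; elim/tens_ind: x => [u v|x y IHx IHy].
  by rewrite tens_liftE.
by rewrite !linearD IHx IHy.
Qed.

End Lift.
End TensorType.

Notation "u \ox v" := (tens u v) : ring_scope.

Lemma tens_linear_ext (k : fieldType) (U V W : lmodType k)
    (f g : {linear tensor U V -> W}) :
  (forall u v, f (u \ox v) = g (u \ox v)) -> f =1 g.
Proof.
move=> fg x; elim/tens_ind: x => [//|x y IHx IHy].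
by rewrite !linearD IHx IHy.
Qed.

Section TensorMap.
Variables (k : fieldType) (U U' V V' : lmodType k).
Variables (f : {linear U -> U'}) (g : {linear V -> V'}).

Definition tens_map2 (u : U) (v : V) : tensor U' V' := f u \ox g v.

Lemma tens_map2_is_bilinear : bilinear_for *:%R *:%R tens_map2.
Proof.
rewrite /tens_map2; apply: bilinearDZ => [v u u'|u v v'|a u v|a u v].
- by rewrite linearD linearDl.
- by rewrite linearD linearDr.
- by rewrite linearZ linearZl_LR.
- by rewrite linearZ linearZr_LR.
Qed.

HB.instance Definition _ := bilinear_isBilinear.Build k U V (tensor U' V')
  *:%R *:%R tens_map2 tens_map2_is_bilinear.

Definition tens_map : {linear tensor U V -> tensor U' V'} :=
  tens_lift tens_map2.

Lemma tens_mapE u v : tens_map (u \ox v) = f u \ox g v.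
Proof. exact: tens_liftE. Qed.

End TensorMap.

Section TensorAssoc.
Variables (k : fieldType) (U V W : lmodType k).

Definition tens_assoc2 (x : tensor U V) (w : W) : tensor U (tensor V W) :=
  tens_map idfun (applyr (@tens k V W) w) x.

Lemma tens_assoc2E u v w : tens_assoc2 (u \ox v) w = u \ox (v \ox w).
Proof. exact: tens_mapE. Qed.

Lemma tens_assoc2_is_bilinear : bilinear_for *:%R *:%R tens_assoc2.
Proof.
apply: bilinearDZ => [w x y|x w w'|a x w|a x w].
- exact: linearD.
- elim/tens_ind: x => [u v|x y IHx IHy].
    by rewrite !tens_assoc2E !linearDr.
  by rewrite /tens_assoc2 !linearD -!/(tens_assoc2 _ _) IHx IHy addrACA.
- exact: linearZ.
- elim/tens_ind: x => [u v|x y IHx IHy].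
    by rewrite !tens_assoc2E !linearZr_LR.
  by rewrite /tens_assoc2 !linearD -!/(tens_assoc2 _ _) IHx IHy.
Qed.

HB.instance Definition _ := bilinear_isBilinear.Build k (tensor U V) W
  (tensor U (tensor V W)) *:%R *:%R tens_assoc2 tens_assoc2_is_bilinear.

Definition tens_assoc :
    {linear tensor (tensor U V) W -> tensor U (tensor V W)} :=
  tens_lift tens_assoc2.

Lemma tens_assocE u v w : tens_assoc (u \ox v \ox w) = u \ox (v \ox w).
Proof. by rewrite -tens_assoc2E; apply: tens_liftE. Qed.

End TensorAssoc.

Arguments tens_assoc {k U V W}.

Section TensorAlgebra.
Variables (k : fieldType) (A B : algType k).

Definition tens_mul1 (y : tensor A B) (a : A) (b : B) : tensor A B :=
  tens_map (a \*o idfun) (b \*o idfun) y.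

Lemma tens_mul1E a b a' b' :
  tens_mul1 (a' \ox b') a b = (a * a') \ox (b * b').
Proof. exact: tens_mapE. Qed.

Lemma tens_mul1D x y a b :
  tens_mul1 (x + y) a b = tens_mul1 x a b + tens_mul1 y a b.
Proof. exact: linearD. Qed.

Lemma tens_mul1_is_bilinear y : bilinear_for *:%R *:%R (tens_mul1 y).
Proof.
apply: bilinearDZ => [v u u'|u v v'|a u v|a u v];
  elim/tens_ind: y => [a' b'|x y IHx IHy];
  rewrite ?tens_mul1E ?tens_mul1D ?IHx ?IHy ?scalerDr //; try exact: addrACA.
- by rewrite mulrDl linearDl.
- by rewrite mulrDl linearDr.
- by rewrite -scalerAl linearZl_LR.
- by rewrite -scalerAl linearZr_LR.
Qed.

HB.instance Definition _ y := bilinear_isBilinear.Build k A B (tensor A B)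
  *:%R *:%R (tens_mul1 y) (tens_mul1_is_bilinear y).

Definition tens_mul (x y : tensor A B) : tensor A B :=
  tens_lift (tens_mul1 y) x.

Lemma tens_mulE a b a' b' :
  tens_mul (a \ox b) (a' \ox b') = (a * a') \ox (b * b').
Proof. by rewrite -tens_mul1E; apply: tens_liftE. Qed.

Lemma tens_mulDl : left_distributive tens_mul +%R.
Proof. by move=> x y z; apply: linearD. Qed.

Lemma tens_mulDr : right_distributive tens_mul +%R.
Proof.
move=> x y z; elim/tens_ind: x => [a b|x x' IHx IHx'].
  by rewrite /tens_mul !tens_liftE; apply: tens_mul1D.
by rewrite !tens_mulDl IHx IHx' addrACA.
Qed.

Lemma tens_mulA : associative tens_mul.
Proof.
move=> x y z; elim/tens_ind: x => [a b|x x' IHx IHx']; last first.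
  by rewrite !tens_mulDl IHx IHx'.
elim/tens_ind: y => [a' b'|y y' IHy IHy']; last first.
  by rewrite !(tens_mulDl, tens_mulDr) IHy IHy'.
elim/tens_ind: z => [a'' b''|z z' IHz IHz']; last first.
  by rewrite !tens_mulDr IHz IHz'.
by rewrite !tens_mulE !mulrA.
Qed.

Lemma tens_mul1l : left_id (1 \ox 1) tens_mul.
Proof.
move=> x; elim/tens_ind: x => [a b|x x' IHx IHx'].
  by rewrite tens_mulE !mul1r.
by rewrite tens_mulDr IHx IHx'.
Qed.

Lemma tens_mul1r : right_id (1 \ox 1) tens_mul.
Proof.
move=> x; elim/tens_ind: x => [a b|x x' IHx IHx'].
  by rewrite tens_mulE !mulr1.
by rewrite tens_mulDl IHx IHx'.
Qed.

HB.instance Definition _ := GRing.Zmodule_isPzRing.Build (tensor A B)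
  tens_mulA tens_mul1l tens_mul1r tens_mulDl tens_mulDr.

Lemma tensM (a a' : A) (b b' : B) :
  (a \ox b) * (a' \ox b') = (a * a') \ox (b * b').
Proof. exact: tens_mulE. Qed.

Lemma tens11 : 1 = 1 \ox 1 :> tensor A B. Proof. by []. Qed.

End TensorAlgebra.

HB.mixin Record Lmodule_isCoalgebra (k : fieldType) C of GRing.Lmodule k C := {
  comul : {linear C -> tensor C C};
  counit : {linear C -> k^o};
  comulA : forall x : C,
    tens_assoc (tens_map comul idfun (comul x)) =
    tens_map idfun comul (comul x);
  counitl : forall x : C, tens_map counit idfun (comul x) = (1 : k^o) \ox x;
  counitr : forall x : C, tens_map idfun counit (comul x) = x \ox (1 : k^o)
}.

#[short(type="coalgType")]
HB.structure Definition Coalgebra (k : fieldType) :=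
  {C of GRing.Lmodule k C & Lmodule_isCoalgebra k C}.

HB.mixin Record Coalgebra_isBialgebra (k : fieldType) B
    of GRing.Algebra k B & Coalgebra k B := {
  comul_monoid_morphism : monoid_morphism (@comul k B);
  counit_monoid_morphism : monoid_morphism (@counit k B)
}.

#[short(type="bialgType")]
HB.structure Definition Bialgebra (k : fieldType) :=
  {B of GRing.Algebra k B & Coalgebra k B & Coalgebra_isBialgebra k B}.

Lemma mulr_is_bilinear (k : fieldType) (A : algType k) :
  bilinear_for *:%R *:%R (@GRing.mul A).
Proof.
apply: bilinearDZ => [v u u'|u v v'|a u v|a u v].
- exact: mulrDl.
- exact: mulrDr.
- by rewrite -scalerAl.
- by rewrite -scalerAr.
Qed.

Section Convolution.
Variables (k : fieldType) (C : coalgType k) (A : algType k).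

Definition alg_mul (a b : A) : A := a * b.
HB.instance Definition _ := bilinear_isBilinear.Build k A A A
  *:%R *:%R alg_mul (mulr_is_bilinear A).

Definition mul_map : {linear tensor A A -> A} := tens_lift alg_mul.

Lemma mul_mapE a b : mul_map (a \ox b) = a * b.
Proof. exact: tens_liftE. Qed.

Definition conv (f g : {linear C -> A}) : {linear C -> A} :=
  mul_map \o (tens_map f g \o comul).

Lemma convE f g x : conv f g x = mul_map (tens_map f g (comul x)).
Proof. by []. Qed.

Definition unit_map (c : k^o) : A := (c : k) *: 1.

Lemma unit_map_is_linear : linear unit_map.
Proof. by move=> a c d; rewrite /unit_map scalerDl scalerA. Qed.

HB.instance Definition _ := GRing.isLinear.Build k k^o A *:%R unit_map
  unit_map_is_linear.

Definition conv_unit : {linear C -> A} := unit_map \o counit.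

Lemma linear_ext (f g : {linear C -> A}) : f =1 g -> f = g.
Proof.
case: f g => [f [[[f0 fD]] [fZ]]] [g [[[g0 gD]] [gZ]]] /= /funext fg.
rewrite fg in f0 fD fZ *.
by rewrite (Prop_irrelevance f0 g0) (Prop_irrelevance fD gD)
           (Prop_irrelevance fZ gZ).
Qed.

Lemma tens_map_add_l (f f' g : {linear C -> A}) t :
  tens_map (f \+ f') g t = tens_map f g t + tens_map f' g t.
Proof.
elim/tens_ind: t => [u v|x y IHx IHy]; last by rewrite !linearD IHx IHy addrACA.
by rewrite !tens_mapE linearDl.
Qed.

Lemma tens_map_add_r (f g g' : {linear C -> A}) t :
  tens_map f (g \+ g') t = tens_map f g t + tens_map f g' t.
Proof.
elim/tens_ind: t => [u v|x y IHx IHy]; last by rewrite !linearD IHx IHy addrACA.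
by rewrite !tens_mapE linearDr.
Qed.

Lemma tens_map_scale_l a (f g : {linear C -> A}) t :
  tens_map (a \*: f) g t = a *: tens_map f g t.
Proof.
elim/tens_ind: t => [u v|x y IHx IHy]; last by rewrite !linearD IHx IHy.
by rewrite !tens_mapE linearZl_LR.
Qed.

Lemma tens_map_scale_r a (f g : {linear C -> A}) t :
  tens_map f (a \*: g) t = a *: tens_map f g t.
Proof.
elim/tens_ind: t => [u v|x y IHx IHy]; last by rewrite !linearD IHx IHy.
by rewrite !tens_mapE linearZr_LR.
Qed.

Lemma convA (f g h : {linear C -> A}) : conv f (conv g h) = conv (conv f g) h.
Proof.
apply: linear_ext => x.
pose F : {linear tensor C (tensor C C) -> A} :=
  mul_map \o tens_map f (mul_map \o tens_map g h).
have Fl t : mul_map (tens_map f (conv g h) t) = F (tens_map idfun comul t).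
  elim/tens_ind: t => [u v|s t IHs IHt]; last by rewrite !linearD IHs IHt.
  by rewrite /F /= !tens_mapE.
have Fr t : mul_map (tens_map (conv f g) h t) =
    F (tens_assoc (tens_map comul idfun t)).
  elim/tens_ind: t => [u v|s t IHs IHt]; last by rewrite !linearD IHs IHt.
  rewrite !tens_mapE mul_mapE convE /=.
  elim/tens_ind: (comul u) => [a b|s t IHs IHt].
    by rewrite tens_assocE tens_mapE !mul_mapE /F /= !tens_mapE /= !mul_mapE
               tens_mapE mul_mapE mulrA.
  by rewrite linearDl !linearD mulrDl IHs IHt.
by rewrite !convE Fl Fr comulA.
Qed.

Lemma conv1f (f : {linear C -> A}) : conv conv_unit f = f.
Proof.
apply: linear_ext => x; rewrite convE.
pose F : {linear tensor k^o C -> A} :=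
  mul_map \o tens_map unit_map f.
have -> t : mul_map (tens_map conv_unit f t) = F (tens_map counit idfun t).
  elim/tens_ind: t => [u v|s t IHs IHt]; last by rewrite !linearD IHs IHt.
  by rewrite /F /= !tens_mapE.
by rewrite counitl /F /= tens_mapE mul_mapE /= /unit_map scale1r mul1r.
Qed.

Lemma convf1 (f : {linear C -> A}) : conv f conv_unit = f.
Proof.
apply: linear_ext => x; rewrite convE.
pose F : {linear tensor C k^o -> A} :=
  mul_map \o tens_map f unit_map.
have -> t : mul_map (tens_map f conv_unit t) = F (tens_map idfun counit t).
  elim/tens_ind: t => [u v|s t IHs IHt]; last by rewrite !linearD IHs IHt.
  by rewrite /F /= !tens_mapE.
by rewrite counitr /F /= tens_mapE mul_mapE /= /unit_map scale1r mulr1.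
Qed.

End Convolution.

Section ConvolutionAlgebra.
Variables (k : fieldType) (B : bialgType k).

(* End_k(B), with the convolution product as its multiplication. *)
Definition conv_end := {linear B -> B}.

HB.instance Definition _ := gen_eqMixin conv_end.
HB.instance Definition _ := gen_choiceMixin conv_end.

Implicit Types f g h : conv_end.

Definition conv_end_zero : conv_end := (\0 : {linear B -> B}).
Definition conv_end_opp f : conv_end :=
  (\- (f : {linear B -> B}) : {linear B -> B}).
Definition conv_end_add f g : conv_end :=
  ((f : {linear B -> B}) \+ (g : {linear B -> B}) : {linear B -> B}).
Definition conv_end_scale (a : k) f : conv_end :=
  (a \*: (f : {linear B -> B}) : {linear B -> B}).
Definition conv_end_mul f g : conv_end := conv f g.
Definition conv_end_one : conv_end := conv_unit B B.

Lemma conv_end_addA : associative conv_end_add.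
Proof. by move=> f g h; apply: linear_ext => x /=; rewrite addrA. Qed.
Lemma conv_end_addC : commutative conv_end_add.
Proof. by move=> f g; apply: linear_ext => x /=; rewrite addrC. Qed.
Lemma conv_end_add0 : left_id conv_end_zero conv_end_add.
Proof. by move=> f; apply: linear_ext => x /=; rewrite add0r. Qed.
Lemma conv_end_addN : left_inverse conv_end_zero conv_end_opp conv_end_add.
Proof. by move=> f; apply: linear_ext => x /=; rewrite addNr. Qed.

HB.instance Definition _ := GRing.isZmodule.Build conv_end
  conv_end_addA conv_end_addC conv_end_add0 conv_end_addN.

Lemma conv_end_scaleA a b f :
  conv_end_scale a (conv_end_scale b f) = conv_end_scale (a * b) f.
Proof. by apply: linear_ext => x /=; rewrite scalerA. Qed.
Lemma conv_end_scale1 : left_id 1 conv_end_scale.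
Proof. by move=> f; apply: linear_ext => x /=; rewrite scale1r. Qed.
Lemma conv_end_scaleDr : right_distributive conv_end_scale +%R.
Proof. by move=> a f g; apply: linear_ext => x /=; rewrite scalerDr. Qed.
Lemma conv_end_scaleDl f : {morph conv_end_scale^~ f : a b / a + b}.
Proof. by move=> a b; apply: linear_ext => x /=; rewrite scalerDl. Qed.

HB.instance Definition _ := GRing.Zmodule_isLmodule.Build k conv_end
  conv_end_scaleA conv_end_scale1 conv_end_scaleDr conv_end_scaleDl.

Lemma conv_end_mulA : associative conv_end_mul.
Proof. by move=> f g h; apply: convA. Qed.
Lemma conv_end_mul1l : left_id conv_end_one conv_end_mul.
Proof. by move=> f; apply: conv1f. Qed.
Lemma conv_end_mul1r : right_id conv_end_one conv_end_mul.
Proof. by move=> f; apply: convf1. Qed.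
Lemma conv_end_mulDl : left_distributive conv_end_mul +%R.
Proof.
move=> f g h; apply: linear_ext => x.
by rewrite [LHS]convE tens_map_add_l linearD.
Qed.
Lemma conv_end_mulDr : right_distributive conv_end_mul +%R.
Proof.
move=> f g h; apply: linear_ext => x.
by rewrite [LHS]convE tens_map_add_r linearD.
Qed.
Lemma conv_end_one_neq0 : conv_end_one != 0.
Proof.
apply/eqP => /(congr1 (fun f : conv_end => (f : {linear B -> B}) 1)).
move=> /eqP; apply/negP; rewrite /= /unit_map.
by rewrite (counit_monoid_morphism (s := B)).1 scale1r oner_eq0.
Qed.

HB.instance Definition _ := GRing.Zmodule_isNzRing.Build conv_end
  conv_end_mulA conv_end_mul1l conv_end_mul1r conv_end_mulDl conv_end_mulDr
  conv_end_one_neq0.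

Lemma conv_end_scaleAl a f g : a *: (f * g) = (a *: f) * g.
Proof.
apply: linear_ext => x.
by apply: esym; rewrite [LHS]convE tens_map_scale_l linearZ.
Qed.
Lemma conv_end_scaleAr a f g : a *: (f * g) = f * (a *: g).
Proof.
apply: linear_ext => x.
by apply: esym; rewrite [LHS]convE tens_map_scale_r linearZ.
Qed.

HB.instance Definition _ :=
  GRing.Lmodule_isLalgebra.Build k conv_end conv_end_scaleAl.
HB.instance Definition _ :=
  GRing.Lalgebra_isAlgebra.Build k conv_end conv_end_scaleAr.

Definition conv_id : conv_end := (idfun : {linear B -> B}).

End ConvolutionAlgebra.

Definition algebraic_over (k : fieldType) (A : algType k) (a : A) : Prop :=
  exists2 p : {poly k}, p != 0 & horner_alg a p = 0.

Definition finite_dimensional (k : fieldType) (V : lmodType k) : Prop :=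
  exists (n : nat) (e : 'I_n -> V),
    forall v : V, exists c : 'I_n -> k, v = \sum_(i < n) c i *: e i.

Section Antipodes.
Variables (k : fieldType) (B : bialgType k).
Local Notation Id := (conv_id B).

Definition left_antipode_at (n : nat) (S : conv_end B) : Prop :=
  S * Id ^+ n.+1 = Id ^+ n.

Definition right_antipode_at (n : nat) (S : conv_end B) : Prop :=
  Id ^+ n.+1 * S = Id ^+ n.

(* For n = 0 this is the antipode of a Hopf algebra, as Id ^+ 0 is the unit   *)
(* composed with the counit.                                                  *)
Definition left_antipode (n : nat) (S : conv_end B) : Prop :=
  left_antipode_at n S /\
  forall (m : nat) (T : conv_end B), left_antipode_at m T -> (n <= m)%N.

Definition right_antipode (n : nat) (S : conv_end B) : Prop :=
  right_antipode_at n S /\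
  forall (m : nat) (T : conv_end B), right_antipode_at m T -> (n <= m)%N.

Definition two_sided_antipode (n : nat) (S : conv_end B) : Prop :=
  left_antipode n S /\ right_antipode n S.

End Antipodes.

(* Main.v *)
Require Import Defs.
From mathcomp Require Import all_boot all_order all_algebra.
From mathcomp Require Import boolp.
Import GRing.Theory.
Local Open Scope ring_scope.

(** Everything takes place in the convolution algebra A = End_k(B), for the
    element a = Id.  Factoring a nonzero annihilating polynomial of a as
    X^m q with q(0) != 0 and solving q(a) a^m = 0 for the constant term of q
    gives a^m = t(a) a^(m+1) for some polynomial t [algebraic_strongly_regular].
    Put T = t(a); it commutes with a.

    The same T is an n-antipode for the minimal n, whichever side minimality
    refers to.  Indeed, let S be any element with S a^(n+1) = a^n.  Iterating
    gives a^n = S^m a^(n+m), so that a^n belongs to A a^m; since a^m is fixed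
    under right multiplication by a T, so is a^n, that is, T a^(n+1) = a^n
    [left_solution_transfer].  The mirror argument [right_solution_transfer]
    handles a solution on the right.  Hence the left and the right equation are
    solvable for the same exponents, namely those at which T solves both, and T
    is a two-sided antipode at the least of them.

    In finite dimension, a linear endomorphism is recorded by a vector of d^2
    coordinates (d the size of a spanning family), so that d^2 + 1 powers of a
    satisfy a nontrivial linear relation; its coefficients are those of an
    annihilating polynomial. *)

Lemma left_solution_iter {R : nzRingType} {a S : R} {n : nat} :
  S * a ^+ n.+1 = a ^+ n -> forall j, S ^+ j * a ^+ (n + j) = a ^+ n.
Proof.
move=> Sa; elim=> [|j IHj]; first by rewrite expr0 mul1r addn0.
by rewrite exprSr -mulrA -addSnnS exprD [S * _]mulrA Sa -exprD.
Qed.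

Lemma right_solution_iter {R : nzRingType} {a S : R} {n : nat} :
  a ^+ n.+1 * S = a ^+ n -> forall j, a ^+ (j + n) * S ^+ j = a ^+ n.
Proof.
move=> aS; elim=> [|j IHj]; first by rewrite expr0 mulr1.
by rewrite exprS mulrA addSnnS exprD -[_ * S]mulrA aS -exprD.
Qed.

(** By iteration, [a ^+ n] is a left multiple of [a ^+ m], and right
    multiplication by [a * T] fixes all left multiples of [a ^+ m]. *)
Lemma left_solution_transfer {R : nzRingType} {a S T : R} {m n : nat} :
  T * a = a * T -> T * a ^+ m.+1 = a ^+ m ->
  S * a ^+ n.+1 = a ^+ n -> T * a ^+ n.+1 = a ^+ n.
Proof.
move=> aT Tm /left_solution_iter /(_ m) Sa.
have aTX l : T * a ^+ l = a ^+ l * T by apply: commrX.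
rewrite aTX exprSr -{1}Sa exprD -!mulrA [a ^+ m * (a * T)]mulrA -exprSr -aTX Tm.
by rewrite -exprD Sa.
Qed.

(** Here [a ^+ n] is a right multiple of [a ^+ m], hence fixed under left
    multiplication by [T * a]. *)
Lemma right_solution_transfer {R : nzRingType} {a S T : R} {m n : nat} :
  T * a ^+ m.+1 = a ^+ m ->
  a ^+ n.+1 * S = a ^+ n -> T * a ^+ n.+1 = a ^+ n.
Proof.
move=> Tm /right_solution_iter /(_ m) aS.
rewrite exprS mulrA -{1}aS exprD !mulrA -[T * a * _]mulrA -exprS Tm.
by rewrite -exprD aS.
Qed.

(** The extra factor [a ^+ j] absorbs the powers of X dividing the annihilating
    polynomial, so that induction on [p] one coefficient at a time ends at its
    first nonzero coefficient, which can be inverted. *)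
Lemma annihilated_strongly_regular (k : fieldType) (A : algType k) (a : A)
    (p : {poly k}) (j : nat) :
  p != 0 -> horner_alg a p * a ^+ j = 0 ->
  exists (m : nat) (t : {poly k}), horner_alg a t * a ^+ m.+1 = a ^+ m.
Proof.
elim/poly_ind: p j => [j|p c IHp j]; first by rewrite eqxx.
rewrite rmorphD rmorphM /= horner_algX horner_algC mulrDl -mulrA -exprS.
have [->|c0] := eqVneq c 0.
  rewrite addr0 scale0r mul0r addr0 mulf_eq0 polyX_eq0 orbF.
  exact: IHp.
move=> _ /eqP; rewrite addr_eq0 => /eqP pa.
exists j, (- c^-1 *: p).
rewrite linearZ /= mulr_algl -scalerAl pa mulr_algl scaleNr scalerN opprK.
by rewrite scalerA mulVf ?scale1r.
Qed.

Lemma algebraic_strongly_regular {k : fieldType} {A : algType k} {a : A} :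
  algebraic_over a ->
  exists (m : nat) (T : A), T * a = a * T /\ T * a ^+ m.+1 = a ^+ m.
Proof.
case=> p p0 pa; have [|m [t ta]] := @annihilated_strongly_regular k A a p 0 p0.
  by rewrite pa mul0r.
exists m, (horner_alg a t); split=> //.
by rewrite -{2 3}(horner_algX a) -!rmorphM mulrC.
Qed.

Lemma conv_end_sumE (k : fieldType) (B : bialgType k) (I : finType)
    (F : I -> conv_end B) (x : B) :
  (\sum_i F i : conv_end B) x = \sum_i F i x.
Proof. by elim/big_rec2: _ => [//|i y f _ <-]. Qed.

(** A convolution power is treated here as a mere linear map: only the values of
    the endomorphisms on a spanning family matter for linear dependence. *)
Lemma finite_dimensional_algebraic (k : fieldType) (B : bialgType k)
    (f : conv_end B) :
  finite_dimensional B -> algebraic_over f.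
Proof.
case=> d [e espan].
have /choice [c cE] : forall ij : 'I_(d * d).+1 * 'I_d, exists c : 'I_d -> k,
    (f ^+ ij.1 : conv_end B) (e ij.2) = \sum_(l < d) c l *: e l.
  by move=> ij; apply: espan.
pose M := \matrix_(i < (d * d).+1) mxvec (\matrix_(j < d, l < d) c (i, j) l).
(* M has more rows than columns, so some nonzero row vector annihilates it. *)
have : kermx M != 0.
  by rewrite kermx_eq0 /row_free neq_ltn ltnS rank_leq_col.
case/rowV0Pn=> v /sub_kermxP vM v0.
exists (rVpoly v).
  by apply: contra_neq v0 => pv; rewrite -[v]rVpolyK pv linear0.
have sumE : horner_alg f (rVpoly v) = \sum_(i < (d * d).+1) v 0 i *: f ^+ i.
  rewrite /rVpoly poly_def rmorph_sum /=; apply: eq_bigr => i _.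
  rewrite linearZ /= mulr_algl rmorphXn /= horner_algX.
  by case: insubP => [i' _ /val_inj ->|]; rewrite ?ltn_ord.
have vanish j : horner_alg f (rVpoly v) (e j) = 0.
  rewrite sumE conv_end_sumE.
  under eq_bigr => i _ do
    rewrite -[(_ *: _ : conv_end B) _]/(v 0 i *: (f ^+ i : conv_end B) (e j))
            (cE (i, j)) scaler_sumr.
  rewrite exchange_big big1 // => l _ /=.
  under eq_bigr do rewrite scalerA.
  rewrite -scaler_suml.
  have /matrixP/(_ 0 (mxvec_index j l)) := vM; rewrite !mxE.
  under eq_bigr do rewrite mxE mxvecE mxE.
  by move=> ->; rewrite scale0r.
apply: linear_ext => x; have [a ->] := espan x.
rewrite linear_sum big1 // => j _.
by rewrite linearZ /= vanish scaler0.
Qed.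

Theorem corollary2p28 (k : fieldType) (B : bialgType k) :
  (finite_dimensional B -> algebraic_over (conv_id B)) /\
  (algebraic_over (conv_id B) ->
     exists (n : nat) (S : conv_end B),
       [/\ left_antipode n S,
           S * conv_id B = conv_id B * S
         & two_sided_antipode n S]).
Proof.
split; first exact: finite_dimensional_algebraic.
case/algebraic_strongly_regular=> m [T [comT Tm]].
pose solves n := T * conv_id B ^+ n.+1 == conv_id B ^+ n.
have ex_n : exists n, solves n by exists m; apply/eqP.
case: (ex_minnP ex_n) => n /eqP Tn n_min.
have Tl : left_antipode n T.
  by split=> // l S /(left_solution_transfer comT Tm)/eqP/n_min.
have Tr : right_antipode n T.
  split=> [|l S /(right_solution_transfer Tm)/eqP/n_min //].
  by rewrite /right_antipode_at -Tn; apply/esym/commrX.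
by exists n, T.
Qed.
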